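(* Let $\mu$ be a Borel probability measure on $\mathbb{R}$. Suppose that there exists $C>0$ such that $|\widehat{\mu}(\xi)|\le C|\xi|^{-1}$ for all $\xi\in\mathbb{R}\setminus\{0\}$. Let $A>0$ and let $\Lambda=\{\lambda_k\}_{k\in\mathbb{Z}}\subset\mathbb{R}$ be a countable set, enumerated in strictly increasing order, such that $$\sum_{\lambda\in\Lambda}\Big|\int f(x)e^{-2\pi i\lambda x}\,d\mu(x)\Big|^2\ge A\int|f(x)|^2\,d\mu(x)\qquad\text{for all } f\in L^2(\mu).$$ Then $$g_{\min}(\Lambda)\,g_{\max}(\Lambda)\le\frac{C^2\pi^2}{A}.$$
   Context: The Fourier transform of $\mu$ is $\widehat{\mu}(\xi)=\int e^{-2\pi i\xi x}\,d\mu(x)$. For a set $\Lambda=\{\lambda_k\}_{k\in\mathbb{Z}}\subset\mathbb{R}$ with $\lambda_n<\lambda_m$ whenever $n<m$, the spectral gaps are $g_k(\Lambda):=\lambda_k-\lambda_{k-1}$, $k\in\mathbb{Z}$. The essential minimal and essential maximal spectral gaps are $$g_{\min}(\Lambda):=\inf\{c\ge 0: g_k(\Lambda)<c\text{ for infinitely many }k\},$$ $$g_{\max}(\Lambda):=\sup\{c\ge 0: g_k(\Lambda)>c\text{ for infinitely many }k\}.$$ These take values in $[0,\infty]$, with $\inf\emptyset=\infty$ and the convention $0\cdot\infty=0$. *)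

(* Defs.v *)
From HB Require Import structures.
From mathcomp Require Import all_boot all_order all_algebra.
From mathcomp Require Import complex.
From mathcomp Require Import all_classical all_reals all_analysis.

Set Implicit Arguments.
Unset Strict Implicit.
Unset Printing Implicit Defensive.

Import Order.TTheory GRing.Theory Num.Theory.
Import numFieldNormedType.Exports.

Local Open Scope classical_set_scope.
Local Open Scope ring_scope.
Local Open Scope complex_scope.

(* The modulus of a complex number as an element of R; the norm `|z| of
   the numDomainType R[i] has values in R[i]. *)
Notation cmod := ComplexField.Normc.normc.

Section complex_functions.
Context {R : realType}.
Implicit Types (mu : probability (measurableTypeR R) R).
Implicit Types (f : measurableTypeR R -> R[i]).

Definition expi (t : R) : R[i] := cos t +i* sin t.

(* R[i] carries no sigma-algebra in the libraries; its Borel sigma-algebra is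
   that of R * R. *)
Definition measurable_funC f : Prop :=
  measurable_fun setT (fun x => complex.Re (f x)) /\
  measurable_fun setT (fun x => complex.Im (f x)).

Definition integralC mu f : R[i] :=
  (\int[mu]_x complex.Re (f x)) +i* (\int[mu]_x complex.Im (f x)).

Definition L2 mu : set (measurableTypeR R -> R[i]) :=
  [set f | measurable_funC f /\ (\int[mu]_x (cmod (f x) ^+ 2)%:E < +oo)%E].

Definition fourier mu (xi : R) : R[i] :=
  integralC mu (fun x => expi (- (2 * pi * xi * x))).

End complex_functions.

Section spectral_gaps.
Context {R : realType}.
Implicit Type lam : int -> R.
Local Open Scope ereal_scope.

Definition gap lam (k : int) : R := (lam k - lam (k - 1))%R.

Definition gmin lam : \bar R :=
  ereal_inf [set c%:E | c in
    [set c : R | (0 <= c)%R /\ infinite_set [set k | (gap lam k < c)%R]]].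

Definition gmax lam : \bar R :=
  ereal_sup [set c%:E | c in
    [set c : R | (0 <= c)%R /\ infinite_set [set k | (c < gap lam k)%R]]].

End spectral_gaps.

(* Main.v *)
(* Testing the frame inequality on the characters [x |-> e^(2 pi i xi x)] gives
   [A <= sum_l |mu^(l - xi)|^2 <= C^2 sum_l |l - xi|^(-2)] for every [xi].
   Let [m < gmin], so that all but finitely many gaps are at least [m], and
   take [xi] to be the midpoint of a gap [G > c] lying far from the exceptional
   ones.  Up to an error that vanishes as the gap goes to infinity, the points
   on either side of [xi] are at distance at least [G/2 + j m], [j >= 0].  With
   [t = m/G <= 1], the bound
   [sum_j t/(1 + 2jt)^2 <= sum_j 1/(1 + 2j)^2 = pi^2/8]
   turns this into [A <= C^2 pi^2/(m c)]. *)

Require Import Defs.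
From HB Require Import structures.
From mathcomp Require Import all_boot all_order all_algebra.
From mathcomp Require Import complex.
From mathcomp Require Import all_classical all_reals all_analysis.
From mathcomp Require Import measurable_realfun.
From mathcomp Require Import ring lra zify.

Import Order.TTheory GRing.Theory Num.Theory.
Import numFieldNormedType.Exports.

Local Open Scope classical_set_scope.
Local Open Scope ring_scope.

(** * Sums of inverse squares *)

Lemma sin_le_id (R : realType) (y : R) : 0 <= y -> sin y <= y.
Proof.
move=> y0.
have [x _] := @MVT_segment R sin cos 0 y y0 (fun x _ => is_derive_sin x)
  (continuous_subspaceT (@continuous_sin R)).
rewrite sin0 !subr0 => ->.
by rewrite ler_piMl// cos_le1.
Qed.

(* Iterates [4/sin(2y)^2 = 1/sin(y)^2 + 1/sin(y + pi/2)^2]. *)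
Lemma sum_inv_sqr_sin (R : realType) (n : nat) (x : R) : 0 < x < pi ->
  \sum_(0 <= k < 2 ^ n) (sin ((x + k%:R * pi) / 2 ^+ n) ^+ 2)^-1 =
  4 ^+ n / sin x ^+ 2.
Proof.
move=> /andP[x0 xpi]; elim: n => [|n IHn].
  by rewrite expn0 big_nat1 mul0r addr0 !expr0 divr1 mul1r.
(* The terms of index [k] and [k + 2 ^ n] are paired: their arguments differ by [pi / 2]. *)
rewrite expnS mul2n -addnn (big_cat_nat (n := 2 ^ n)) ?leq_addr//=.
rewrite -{2}[(2 ^ n)%N]add0n big_addn addnK.
rewrite [4 ^+ n.+1]exprS -mulrA -IHn -big_split mulr_sumr /=.
apply: eq_big_nat => k /= kn.
have p0 : (0 : R) < 2 ^+ n by rewrite exprn_gt0.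
set y := (x + k%:R * pi) / 2 ^+ n.+1.
have -> : (x + (k + 2 ^ n)%:R * pi) / 2 ^+ n.+1 = y + pi / 2.
  by rewrite /y natrD natrX exprS; field; rewrite gt_eqF.
have -> : (x + k%:R * pi) / 2 ^+ n = y *+ 2.
  by rewrite /y exprS mulr2n; field; rewrite gt_eqF.
have y0 : 0 < y < pi / 2.
  rewrite /y exprS divr_gt0 ?mulr_gt0//=; last first.
    by rewrite ltr_pwDl// mulr_ge0// pi_ge0.
  rewrite invfM mulrA ltr_pdivrMr// mulrAC ltr_pM2r//.
  apply: (@lt_le_trans _ _ (k.+1%:R * pi)).
    by rewrite -addn1 natrD mulrDl mul1r addrC ltrD2l.
  by rewrite mulrC ler_pM2l ?pi_gt0// -natrX ler_nat.
have s0 : 0 < sin y by apply: sin_gt0_pihalf.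
have c0 : 0 < cos y.
  apply: cos_gt0_pihalf; case/andP: y0 => y0 ->; rewrite andbT.
  by apply: lt_trans y0; rewrite oppr_lt0 divr_gt0// pi_gt0.
rewrite sinDpihalf sin_mulr2n mulr2n.
have := cos2Dsin2 y; move: (sin y) (cos y) s0 c0 => s c s0 c0 sc.
have -> : (s ^+ 2)^-1 + (c ^+ 2)^-1 = (c ^+ 2 + s ^+ 2) / (s ^+ 2 * c ^+ 2).
  by field; rewrite !gt_eqF.
by rewrite sc; field; rewrite !gt_eqF ?addr_gt0 ?mulr_gt0.
Qed.

(** At [x = pi / 2] the sine identity sums [1/sin(y)^2] over [y = (2k + 1) pi / 2^(n+2)]. Half of
    that sum, compared termwise through [sin y <= y], gives exactly [pi^2 / 8]. *)
Lemma sum_inv_odd_sqr_pow2 (R : realType) (n : nat) :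
  \sum_(0 <= k < 2 ^ n) ((2 * k%:R + 1) ^+ 2)^-1 <= pi ^+ 2 / 8 :> R.
Proof.
have pi0 := pi_gt0 R.
have p0 : (0 : R) < 2 ^+ n by rewrite exprn_gt0.
set F := fun k : nat => (sin ((pi / 2 + k%:R * pi) / 2 ^+ n.+1) ^+ 2)^-1 : R.
have tot : \sum_(0 <= k < 2 ^ n.+1) F k = 4 * 4 ^+ n.
  rewrite /F sum_inv_sqr_sin ?sin_pihalf ?expr1n ?divr1 ?exprS//.
  by rewrite divr_gt0//= ltr_pdivrMr// mulr_natr mulr2n ltrDl.
have {tot} half : \sum_(0 <= k < 2 ^ n) F k = 2 * 4 ^+ n.
  suff : \sum_(0 <= k < 2 ^ n.+1) F k = 2 * \sum_(0 <= k < 2 ^ n) F k.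
    by rewrite tot => /eqP; rewrite -subr_eq0 => /eqP h; lra.
  rewrite expnS mul2n -addnn (big_cat_nat (n := 2 ^ n)) ?leq_addr//=.
  rewrite mulr_natl mulr2n; congr (_ + _).
  (* Reversing the second half sends the argument [y] to [pi - y], which has the same sine. *)
  rewrite big_nat_rev -{1}[(2 ^ n)%N]add0n big_addn addnK /=.
  apply: eq_big_nat => k /= kn; congr ((_ ^+ 2)^-1).
  rewrite -[RHS]opprK -sinN -sinDpi; congr sin.
  rewrite (_ : (_ + _ - _)%N = (2 ^ n + 2 ^ n - k.+1)%N); last by lia.
  rewrite natrB ?natrD ?natrX; last by lia.
  by rewrite -addn1 natrD exprS; field; rewrite gt_eqF.
have le k : (k < 2 ^ n)%N ->
    ((2 * k%:R + 1) ^+ 2)^-1 <= pi ^+ 2 / (16 * 4 ^+ n) * F k.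
  move=> kn; rewrite /F.
  set y := (pi / 2 + k%:R * pi) / 2 ^+ n.+1.
  have yE : y = pi * (2 * k%:R + 1) / (4 * 2 ^+ n).
    by rewrite /y exprS; field; rewrite gt_eqF.
  have y0 : 0 < y by rewrite yE !(divr_gt0, mulr_gt0)// ltr_pwDr// mulr_ge0.
  have ypi : y < pi.
    rewrite yE ltr_pdivrMr ?mulr_gt0// ltr_pM2l//.
    have : (k.+1%:R : R) <= 2 ^+ n by rewrite -natrX ler_nat.
    have : (0 : R) <= k%:R by [].
    by rewrite -addn1 natrD; move: (2 ^+ n) k%:R => P K; lra.
  have s0 : 0 < sin y by apply: sin_gt0_pi; rewrite y0.
  have -> : ((2 * k%:R + 1) ^+ 2)^-1 = pi ^+ 2 / (16 * 4 ^+ n) * (y ^+ 2)^-1.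
    have -> : 4 ^+ n = (2 ^+ n) ^+ 2 :> R by rewrite exprAC -(natrX R 2 2).
    have b0 : (0 : R) < 2 * k%:R + 1 by rewrite ltr_pwDr// mulr_ge0.
    rewrite yE; clear -pi0 p0 b0.
    move: (2 ^+ n) p0 (2 * k%:R + 1) b0 pi pi0 => P P0 b b0 p p0.
    by field; rewrite !gt_eqF.
  rewrite ler_pM2l ?divr_gt0 ?exprn_gt0 ?mulr_gt0 ?exprn_gt0//.
  rewrite lef_pV2 ?posrE ?exprn_gt0//.
  by apply: lerXn2r; rewrite ?nnegrE ?sin_le_id ?ltW.
apply: (@le_trans _ _ (\sum_(0 <= k < 2 ^ n) pi ^+ 2 / (16 * 4 ^+ n) * F k)).
  by rewrite !big_nat; apply: ler_sum => k /le.
rewrite -mulr_sumr half le_eqVlt; apply/orP; left; apply/eqP.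
by field; rewrite gt_eqF// exprn_gt0.
Qed.

Lemma sum_inv_odd_sqr (R : realType) (n : nat) :
  \sum_(0 <= k < n) ((2 * k%:R + 1) ^+ 2)^-1 <= pi ^+ 2 / 8 :> R.
Proof.
apply: le_trans (sum_inv_odd_sqr_pow2 R n).
rewrite [leRHS](big_cat_nat (n := n)) ?(ltnW (ltn_expl _ _))//= lerDl.
by apply: sumr_ge0 => k _; rewrite invr_ge0 sqr_ge0.
Qed.

(* The inequality fails termwise: the excess of the term of index [j > 0] is at
   most [(1 - t)/2 (1/(1 + 2(j-1)t) - 1/(1 + 2jt))], and the sum of these is
   absorbed by the deficit [1 - t] of the term of index [0]. *)
Lemma sum_inv_sqr_arith (R : realType) (t : R) (n : nat) : 0 < t <= 1 ->
  \sum_(0 <= j < n) t / (1 + 2 * j%:R * t) ^+ 2 <=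
  \sum_(0 <= j < n) ((2 * j%:R + 1) ^+ 2)^-1.
Proof.
move=> /andP[t0 t1].
have pos (j : nat) : 0 < 1 + 2 * j%:R * t by rewrite ltr_pwDl// !mulr_ge0// ltW.
case: n => [|n]; first by rewrite !big_nil.
(* The subtracted term is the slack still left: the deficit [1 - t] minus the telescoped excess
   [(1 - t)/2 (1 - 1/(1 + 2nt))]. *)
suff : \sum_(0 <= j < n.+1) t / (1 + 2 * j%:R * t) ^+ 2 <=
    \sum_(0 <= j < n.+1) ((2 * j%:R + 1) ^+ 2)^-1
    - (1 - t) / 2 * (1 + (1 + 2 * n%:R * t)^-1).
  move=> /le_trans; apply; rewrite gerBl mulr_ge0 ?divr_ge0 ?subr_ge0//.
  by rewrite addr_ge0// invr_ge0 ltW.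
elim: n => [|n IHn].
  rewrite !big_nat1 !(mulr0, mul0r, addr0, add0r, expr1n, invr1, mulr1).
  by rewrite le_eqVlt; apply/orP; left; apply/eqP; field.
rewrite big_nat_recr//= [in leRHS]big_nat_recr//=.
apply: (le_trans (lerD IHn (lexx _))).
rewrite -!addrA lerD2l -subr_ge0.
set p := 1 + 2 * n%:R * t; set q := 1 + 2 * n.+1%:R * t.
set b := 2 * n.+1%:R + 1.
have p0 : 0 < p := pos n; have q0 : 0 < q := pos n.+1.
have b0 : 0 < b by rewrite ltr_pwDr// mulr_ge0.
have qp : q = p + 2 * t by rewrite /q /p -(addn1 n) natrD; ring.
have qb : q = 1 + (b - 1) * t by rewrite /q /b addrK.
rewrite [X in 0 <= X](_ : _ = (1 - t) *
    (2 * t ^+ 2 * b ^+ 2 + p * (t * (2 * b - 1) + 1)) / (p * q ^+ 2 * b ^+ 2)).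
  apply: divr_ge0; last by rewrite !mulr_ge0// ?exprn_ge0// ltW.
  have b1 : 1 <= b by rewrite lerDr mulr_ge0.
  rewrite mulr_ge0 ?subr_ge0// addr_ge0 ?mulr_ge0 ?exprn_ge0
    ?(ltW t0) ?(ltW p0) ?(ltW b0)//.
  by rewrite addr_ge0// mulr_ge0 ?(ltW t0)//; lra.
have pE : p = 1 + (b - 1) * t - 2 * t by rewrite -qb qp addrK.
move: p0 q0; rewrite pE qb; clearbody b => p0 q0.
by field; rewrite !gt_eqF.
Qed.

Lemma sum_inv_sqr_shift (R : realFieldType) (p n : nat) : (0 < p)%N ->
  \sum_(0 <= i < n) ((p + i).+1%:R ^+ 2)^-1 <= p%:R^-1 :> R.
Proof.
move=> p0.
(* The telescoping form carries the induction: with [x = p + n], [1/x - 1/(x+1)] exceeds [1/(x+1)^2]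
   by [1/(x (x+1)^2)]. *)
suff : \sum_(0 <= i < n) ((p + i).+1%:R ^+ 2)^-1 <=
    p%:R^-1 - (p + n)%:R^-1 :> R.
  by move=> /le_trans; apply; rewrite gerBl invr_ge0.
elim: n => [|n IHn]; first by rewrite big_nil addn0 subrr.
rewrite big_nat_recr//= (le_trans (lerD IHn (lexx _)))// -addrA lerD2l.
rewrite addnS -natr1.
have : (0 : R) < (p + n)%:R by rewrite ltr0n addn_gt0 p0.
move: (p + n)%:R => x x0.
rewrite -subr_ge0 [X in 0 <= X](_ : _ = (x * (x + 1) ^+ 2)^-1).
  by rewrite invr_ge0 mulr_ge0 ?exprn_ge0 ?addr_ge0// ltW.
by field; rewrite !gt_eqF// addr_gt0.
Qed.

(** Meant for the distances from a gap's midpoint to the points on one side, with [a] half the gap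
    and [E] a bound on the number of short gaps. The first [E + p + 1] terms give the sharp
    constant; later ones may lose [E] steps of length [m], yet their sum is [O(1/p)]. *)
Lemma sum_inv_sqr_separated (R : realType) (a m : R) (d : nat -> R)
    (E p : nat) : 0 < m -> m <= 2 * a -> (0 < p)%N ->
  (forall j, (j <= E + p)%N -> a + j%:R * m <= d j) ->
  (forall j, a + (j%:R - E%:R) * m <= d j) ->
  forall n, \sum_(0 <= j < n) (d j ^+ 2)^-1 <=
    pi ^+ 2 / (4 * a * m) + (m ^+ 2 * p%:R)^-1.
Proof.
move=> m0 ma p0 near far n.
have a0 : 0 < a by lra.
have le_invsqr (x y : R) : 0 < x -> x <= y -> (y ^+ 2)^-1 <= (x ^+ 2)^-1.
  move=> x0 xy; have y0 := lt_le_trans x0 xy.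
  by rewrite lef_pV2 ?posrE ?exprn_gt0// lerXn2r// nnegrE ltW.
apply: (@le_trans _ _ (\sum_(0 <= j < (E + p).+1 + n) (d j ^+ 2)^-1)).
  rewrite [leRHS](big_cat_nat (n := n)) ?leq_addl//= lerDl.
  by apply: sumr_ge0 => k _; rewrite invr_ge0 sqr_ge0.
rewrite (big_cat_nat (n := (E + p).+1)) ?leq_addr//=; apply: lerD.
  set t := m / (2 * a).
  have t01 : 0 < t <= 1.
    by rewrite divr_gt0 ?mulr_gt0//= ler_pdivrMr ?mul1r// mulr_gt0.
  (* Rescaling by [a] turns [1/(a + jm)^2] into [2/(am)] times [t/(1 + 2jt)^2]; the hypothesis
     [m <= 2 * a] is [t <= 1]. *)
  apply: (@le_trans _ _ (\sum_(0 <= j < (E + p).+1)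
      2 / (a * m) * (t / (1 + 2 * j%:R * t) ^+ 2))).
    rewrite !big_nat; apply: ler_sum => j /=; rewrite ltnS => jE.
    have j0 : 0 < a + j%:R * m by rewrite ltr_pwDl// mulr_ge0// ltW.
    apply: (le_trans (le_invsqr _ _ j0 (near _ jE))).
    rewrite le_eqVlt; apply/orP; left; apply/eqP; rewrite /t.
    move: (j%:R) j0 => x x0.
    by field; rewrite !gt_eqF// addrC// -addrC; lra.
  rewrite -mulr_sumr.
  have := le_trans (sum_inv_sqr_arith R t (E + p).+1 t01)
    (sum_inv_odd_sqr R (E + p).+1).
  rewrite -(@ler_pM2l _ (2 / (a * m))) ?divr_gt0 ?mulr_gt0//.
  move=> /le_trans; apply; rewrite le_eqVlt; apply/orP; left; apply/eqP.
  by move: pi => P; field; rewrite !gt_eqF.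
rewrite -{1}[(E + p).+1]add0n big_addn addKn invfM.
apply: le_trans (ler_wpM2l _ (sum_inv_sqr_shift R p n p0)); last first.
  by rewrite invr_ge0 exprn_ge0// ltW.
rewrite mulr_sumr; apply: ler_sum => i _; rewrite -invfM -exprMn.
apply: le_invsqr; first by rewrite mulr_gt0.
apply: le_trans (far _).
rewrite (_ : (i + _)%N = (E + (p + i).+1)%N); last by lia.
by rewrite natrD addrAC subrr add0r mulrC lerDr ltW.
Qed.

(** * The frame inequality as a sum of values of the Fourier transform *)

(** Reduces an unordered sum over the spectrum to partial sums along the points on each side of a
    gap. What remains of [S] outside [range u] lies in [range v]. *)
Lemma esum_le_two_sequences (R : realType) (T : choiceType) (u v : nat -> T)
    (S : set T) (F : T -> R) (Bu Bv : R) :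
  injective u -> injective v -> S `<=` range u `|` range v ->
  (forall x, 0 <= F x) ->
  (forall n, \sum_(0 <= j < n) F (u j) <= Bu) ->
  (forall n, \sum_(0 <= j < n) F (v j) <= Bv) ->
  (\esum_(x in S) (F x)%:E <= (Bu + Bv)%:E)%E.
Proof.
move=> uinj vinj Suv F0 Bu_ub Bv_ub.
have esum_subset (X Y : set T) : X `<=` Y ->
    (\esum_(x in X) (F x)%:E <= \esum_(x in Y) (F x)%:E)%E.
  move=> XY; rewrite [leRHS](esumID X); last by move=> x _; rewrite lee_fin.
  by rewrite setIidr// leeDl// esum_ge0// => x _; rewrite lee_fin.
have range_le (w : nat -> T) (B : R) : injective w ->
    (forall n, \sum_(0 <= j < n) F (w j) <= B) ->
    (\esum_(x in range w) (F x)%:E <= B%:E)%E.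
  move=> winj B_ub.
  rewrite esum_image; last by move=> x y _ _; apply: winj.
  rewrite -nneseries_esumT; last by move=> n; rewrite lee_fin.
  apply: lime_le; first by apply: is_cvg_nneseries => n _ _; rewrite lee_fin.
  by apply: nearW => n; rewrite sumEFin lee_fin.
rewrite (esumID (range u)); last by move=> x _; rewrite lee_fin.
rewrite EFinD; apply: leeD.
  apply: le_trans (range_le _ _ uinj Bu_ub).
  by apply: esum_subset => x [].
apply: le_trans (range_le _ _ vinj Bv_ub).
by apply: esum_subset => x [/Suv[]].
Qed.

(** A character has modulus one, hence norm 1 in [L2 mu], and multiplying by it shifts the frequency
    from [l] to [l - xi]. *)
Lemma frame_translate (R : realType) (mu : probability (measurableTypeR R) R)
    (A : R) (S : set R) :
  (forall f : measurableTypeR R -> R[i]%C, L2 mu f ->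
      (A%:E * (\int[mu]_x (cmod (f x) ^+ 2)%:E) <=
       \esum_(l in S)
         (cmod (integralC mu
            (fun x => (f x * expi (- (2 * pi * l * x)))%R)) ^+ 2)%:E)%E) ->
  forall xi : R,
    (A%:E <= \esum_(l in S) (cmod (fourier mu (l - xi)) ^+ 2)%:E)%E.
Proof.
move=> frame xi.
pose f (x : measurableTypeR R) := expi (2 * pi * xi * x).
have f1 x : cmod (f x) ^+ 2 = 1.
  by rewrite /f /expi /= sqr_sqrtr ?cos2Dsin2// addr_ge0// sqr_ge0.
have If : (\int[mu]_x (cmod (f x) ^+ 2)%:E = 1)%E.
  under eq_integral do rewrite f1.
  by rewrite integral_cst// mul1e; exact: probability_setT.
have mlin : measurable_fun setT (fun x : measurableTypeR R => 2 * pi * xi * x).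
  exact: mulrl_measurable.
have L2f : L2 mu f.
  split; last by rewrite If ltry.
  split.
    have mcos := continuous_measurable_fun (@continuous_cos R).
    exact: measurableT_comp mcos mlin.
  have msin := continuous_measurable_fun (@continuous_sin R).
  exact: measurableT_comp msin mlin.
have := frame f L2f; rewrite If mule1.
suff -> : (fun l => (cmod (integralC mu
    (fun x => (f x * expi (- (2 * pi * l * x)))%R)) ^+ 2)%:E) =
    (fun l => (cmod (fourier mu (l - xi)) ^+ 2)%:E) by [].
apply/funext => l; congr ((cmod (integralC mu _) ^+ 2)%:E).
apply/funext => x; rewrite /f.
rewrite (_ : - (2 * pi * (l - xi) * x) =
  2 * pi * xi * x + - (2 * pi * l * x)); last by ring.
rewrite /expi cosD sinD.
by apply/eqP; rewrite eq_complex /=; apply/andP; split; apply/eqP; ring.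
Qed.

(** * Distances between spectral points in terms of gaps *)

Lemma ler_sum_gap (R : realType) (lam : int -> R) (m : R) (i : int) (n : nat) :
  (forall k : int, i < k <= i + n%:Z -> m <= gap lam k) ->
  n%:R * m <= lam (i + n%:Z) - lam i.
Proof.
elim: n => [|n IHn] gap_ge; first by rewrite mul0r addr0 subrr.
have {}IHn := IHn (fun k ik => gap_ge k ltac:(lia)).
have := gap_ge (i + n.+1%:Z) ltac:(lia).
rewrite /gap (_ : i + n.+1%:Z - 1 = i + n%:Z); last by lia.
by rewrite -natr1 mulrDl mul1r; lra.
Qed.

(** The distance telescopes into gaps; each of the at most [2K + 1] exceptional ones is only known
    to be nonnegative and costs one [m]. *)
Lemma ler_sum_gap_except (R : realType) (lam : int -> R) (m : R) (K : nat)
    (i : int) (n : nat) :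
  0 <= m -> (forall k, 0 <= gap lam k) ->
  (forall k : int, (K < `|k|)%N -> m <= gap lam k) ->
  (n%:R - (2 * K + 1)%:R) * m <= lam (i + n%:Z) - lam i.
Proof.
move=> m0 gap0 gap_ge.
(* [b j] is the number of exceptional indices [k <= j] *)
pose b (j : int) : int :=
  if j < - K%:Z then 0 else if K%:Z < j then (2 * K + 1)%N%:Z
  else j + K%:Z + 1.
have b_ge0 j : 0 <= b j.
  by rewrite /b; case: ifP => [|?]; [|case: ifP => ?]; lia.
have b_le j : b j <= (2 * K + 1)%N%:Z.
  by rewrite /b; case: ifP => [|?]; [|case: ifP => ?]; lia.
(* The exact count of exceptional indices met between [i] and [i + n] makes the induction go
   through. *)
have main : (n%:Z - (b (i + n%:Z) - b i))%:~R * m <= lam (i + n%:Z) - lam i.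
  elim: n => [|n IHn]; first by rewrite addr0 !subrr mul0r.
  have -> : lam (i + n.+1%:Z) - lam i =
      gap lam (i + n.+1%:Z) + (lam (i + n%:Z) - lam i).
    rewrite /gap (_ : i + n.+1%:Z - 1 = i + n%:Z); last by lia.
    by rewrite addrA subrK.
  have [far|near] := ltnP K (absz (i + n.+1%:Z)).
    rewrite (_ : _ - _ = 1 + (n%:Z - (b (i + n%:Z) - b i))).
      by rewrite intrD mulrDl mul1r lerD// gap_ge.
    have : b (i + n.+1%:Z) = b (i + n%:Z) by rewrite /b; do !case: ifP; lia.
    lia.
  rewrite (_ : _ - _ = n%:Z - (b (i + n%:Z) - b i)).
    by rewrite ler_wpDl.
  have : b (i + n.+1%:Z) = b (i + n%:Z) + 1 by rewrite /b; do !case: ifP; lia.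
  lia.
apply: le_trans main; rewrite ler_wpM2r// !pmulrn -intrB ler_int.
by have := b_le (i + n%:Z); have := b_ge0 i; lia.
Qed.

Lemma finite_set_int_bounded (S : set int) : finite_set S ->
  exists K : nat, forall k, S k -> (`|k| <= K)%N.
Proof.
move=> /finite_seqP[s ->].
exists (\max_(k <- s) `|k|)%N => k ks.
exact: leq_bigmax_seq.
Qed.

Lemma infinite_set_int_unbounded (S : set int) (L : nat) : infinite_set S ->
  exists2 k, S k & (L < `|k|)%N.
Proof.
move=> Sinf; apply: contrapT => noS; apply: Sinf.
apply: (@sub_finite_set _ _
  [set` [seq i%:Z | i <- iota 0 L.+1] ++ [seq - i%:Z | i <- iota 0 L.+1]]).
  move=> k Sk; rewrite /mkset.
  have kL : (`|k| <= L)%N.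
    by rewrite leqNgt; apply/negP => kL; apply: noS; exists k.
  rewrite mem_cat; apply/orP.
  have [k0|k0] := leP 0 k; [left|right]; apply/mapP; exists `|k|%N;
    rewrite ?mem_iota; lia.
exact: finite_seq.
Qed.

(** * Bounding the product of a gap bound and a large gap *)

Lemma ler_add_divn (R : realType) (x y z : R) : 0 <= z ->
  (forall p : nat, (0 < p)%N -> x <= y + z / p%:R) -> x <= y.
Proof.
move=> z0 xyz; rewrite leNgt; apply/negP => yx.
have d0 : 0 < x - y by rewrite subr_gt0.
have zp := archi_boundP (divr_ge0 z0 (ltW d0)).
set p := Num.bound _ in zp.
have p0 : (0 : R) < p%:R by apply: le_lt_trans zp; rewrite divr_ge0// ltW.
have := xyz p; rewrite -(ltr0n R) => /(_ p0); apply/negP; rewrite -ltNge.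
by rewrite -ltrBrDl ltr_pdivrMr// mulrC -ltr_pdivrMr.
Qed.

Lemma sqr_fourier_le (R : realType) (mu : probability (measurableTypeR R) R)
    (C : R) :
  (forall xi : R, xi != 0 -> cmod (fourier mu xi) <= C * `|xi|^-1) ->
  forall xi : R, xi != 0 ->
    cmod (fourier mu xi) ^+ 2 <= C ^+ 2 * (xi ^+ 2)^-1.
Proof.
move=> decay xi xi0.
rewrite -exprVn -exprMn -(real_normK (num_real (C * xi^-1))).
have h := decay xi xi0.
have f0 : 0 <= cmod (fourier mu xi).
  by case: (fourier mu xi) => ? ?; exact: sqrtr_ge0.
apply: lerXn2r; rewrite ?nnegrE//; apply: (le_trans h).
by rewrite normrM normfV ler_wpM2r ?invr_ge0// ler_norm.
Qed.

(** The size of [k] keeps the [2K + 1 + p] nearest gaps on either side of the [k]-th one away from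
    the exceptional indices. Each side of the midpoint contributes at most [C ^+ 2 * B]. *)
Lemma frame_bound_le (R : realType) (mu : probability (measurableTypeR R) R)
    (C A : R) (lam : int -> R) (m : R) (K p : nat) (k : int) :
  (forall xi : R, xi != 0 -> cmod (fourier mu xi) <= C * `|xi|^-1) ->
  (forall i j : int, i < j -> lam i < lam j) ->
  (forall xi : R, (A%:E <=
    \esum_(l in range lam) (cmod (fourier mu (l - xi)) ^+ 2)%:E)%E) ->
  0 < m -> (0 < p)%N ->
  (forall i : int, (K < `|i|)%N -> m <= gap lam i) ->
  (K + (2 * K + 1) + p < `|k|)%N ->
  A <= C ^+ 2 * pi ^+ 2 / (m * gap lam k) + 2 * C ^+ 2 / m ^+ 2 / p%:R.
Proof.
move=> decay lam_incr frame m0 p0 gap_ge kK.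
have gap0 i : 0 <= gap lam i by rewrite subr_ge0 ltW// lam_incr//; lia.
have lam_inj : injective lam.
  move=> x y xy; apply: contrapT => /eqP; rewrite neq_lt.
  by move=> /orP[] /lam_incr; rewrite xy ltxx.
set G := gap lam k.
have mG : m <= G by apply: gap_ge; lia.
set xi := (lam k + lam (k - 1)) / 2.
pose u (j : nat) := lam (k + j%:Z); pose v (j : nat) := lam (k - 1 - j%:Z).
have C2 : 0 <= C ^+ 2 by exact: sqr_ge0.
set B := pi ^+ 2 / (4 * (G / 2) * m) + (m ^+ 2 * p%:R)^-1.
(* [d j] is the distance from [xi] to [w j]; the choice of sign serves both sides of [xi]. *)
have decay_sum (d w : nat -> R) :
    (forall j, w j - xi = d j \/ w j - xi = - d j) ->
    (forall j, (j <= 2 * K + 1 + p)%N -> G / 2 + j%:R * m <= d j) ->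
    (forall j, G / 2 + (j%:R - (2 * K + 1)%:R) * m <= d j) ->
    (forall j, 0 < d j) ->
    forall n, \sum_(0 <= j < n) cmod (fourier mu (w j - xi)) ^+ 2 <= C ^+ 2 * B.
  move=> wd near far d0 n.
  have ma : m <= 2 * (G / 2) by lra.
  have := sum_inv_sqr_separated _ _ _ d _ _ m0 ma p0 near far n.
  move=> /(ler_wpM2l C2); apply: le_trans; rewrite mulr_sumr.
  apply: ler_sum => j _.
  have -> : d j ^+ 2 = (w j - xi) ^+ 2 by case: (wd j) => ->; rewrite ?sqrrN.
  apply: sqr_fourier_le => //.
  by case: (wd j) => ->; rewrite ?oppr_eq0 gt_eqF.
have G2 : lam k - xi = G / 2 by rewrite /xi /G /gap; lra.
have G2' : xi - lam (k - 1) = G / 2 by rewrite /xi /G /gap; lra.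
have G0 : 0 < G / 2 by lra.
have lam_le i j : i <= j -> lam i <= lam j.
  by rewrite le_eqVlt => /predU1P[->//|/lam_incr/ltW].
have usum : forall n, \sum_(0 <= j < n) cmod (fourier mu (u j - xi)) ^+ 2
    <= C ^+ 2 * B.
  apply: (decay_sum (fun j => u j - xi)) => j; first by left.
  - move=> jp.
    have := ler_sum_gap _ lam m k j (fun i ik => gap_ge i ltac:(lia)).
    by rewrite /u; lra.
  - have := ler_sum_gap_except _ lam m K k j (ltW m0) gap0 gap_ge.
    by rewrite /u; lra.
  - have := lam_le k (k + j%:Z) ltac:(lia); rewrite /u; lra.
have vsum : forall n, \sum_(0 <= j < n) cmod (fourier mu (v j - xi)) ^+ 2
    <= C ^+ 2 * B.
  (* [v] runs downwards, so the gap lemmas start from its far end [k - 1 - j]. *)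
  have vE j : k - 1 - j%:Z + j%:Z = k - 1 by lia.
  apply: (decay_sum (fun j => xi - v j)) => j; first by right; rewrite opprB.
  - move=> jp.
    have := ler_sum_gap _ lam m (k - 1 - j%:Z) j
      (fun i ik => gap_ge i ltac:(lia)).
    by rewrite vE /v; lra.
  - have := ler_sum_gap_except _ lam m K (k - 1 - j%:Z) j (ltW m0) gap0 gap_ge.
    by rewrite vE /v; lra.
  - have := lam_le (k - 1 - j%:Z) (k - 1) ltac:(lia); rewrite /v; lra.
have AB : A <= C ^+ 2 * B + C ^+ 2 * B.
  rewrite -lee_fin; apply: le_trans (frame xi) _.
  apply: (esum_le_two_sequences _ _ u v) => //.
  - by move=> i j /lam_inj; lia.
  - by move=> i j /lam_inj; lia.
  - move=> _ [i _ <-]; have [ki|ik] := leP k i.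
      by left; exists (absz (i - k)%R) => //; rewrite /u; congr lam; lia.
    by right; exists (absz (k - 1 - i)%R) => //; rewrite /v; congr lam; lia.
  - by move=> l; exact: sqr_ge0.
apply: (le_trans AB); rewrite le_eqVlt; apply/orP; left; apply/eqP; rewrite /B.
have Gp : 0 < G by lra.
have pp : (0 : R) < p%:R by rewrite ltr0n.
move: pi (p%:R) pp => P q q0.
by field; rewrite !gt_eqF.
Qed.

Lemma gap_mul_le (R : realType) (mu : probability (measurableTypeR R) R)
    (C A : R) (lam : int -> R) (m c : R) :
  (forall xi : R, xi != 0 -> cmod (fourier mu xi) <= C * `|xi|^-1) ->
  (forall i j : int, i < j -> lam i < lam j) -> 0 < A ->
  (forall xi : R, (A%:E <=
    \esum_(l in range lam) (cmod (fourier mu (l - xi)) ^+ 2)%:E)%E) ->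
  0 < m -> finite_set [set k | gap lam k < m] ->
  0 < c -> infinite_set [set k | c < gap lam k] ->
  m * c <= C ^+ 2 * pi ^+ 2 / A.
Proof.
move=> decay lam_incr A0 frame m0 /finite_set_int_bounded[K gapK] c0 c_inf.
have gap_ge i : (K < `|i|)%N -> m <= gap lam i.
  by move=> Ki; rewrite leNgt; apply/negP => /gapK; lia.
rewrite ler_pdivlMr// mulrC -ler_pdivlMr ?mulr_gt0//.
apply: (@ler_add_divn _ _ _ (2 * C ^+ 2 / m ^+ 2)).
  by apply: divr_ge0; rewrite ?sqr_ge0// mulr_ge0 ?sqr_ge0.
move=> p p0.
(* Gaps above [c] occur at arbitrarily large indices, so [k] can be chosen after [p]; then [p] is
   free to grow and removes the error term. *)
have [k ck Lk] := infinite_set_int_unbounded _ (K + (2 * K + 1) + p) c_inf.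
apply: (le_trans (frame_bound_le _ _ _ _ _ _ _ _ _ decay lam_incr frame m0 p0
  gap_ge Lk)).
have Gp : 0 < gap lam k by apply: lt_trans ck.
rewrite lerD2r -exprMn ler_wpM2l ?sqr_ge0//.
by rewrite lef_pV2 ?posrE ?mulr_gt0// ler_pM2l// ltW.
Qed.

(** * Passage to the essential gaps *)

Theorem theorem1p1 (R : realType) (mu : probability (measurableTypeR R) R)
    (C : R) (C_gt0 : 0 < C)
    (mu_decay : forall xi : R, xi != 0 -> cmod (fourier mu xi) <= C * `|xi|^-1)
    (A : R) (A_gt0 : 0 < A)
    (lam : int -> R) (lam_incr : forall m n : int, m < n -> lam m < lam n)
    (lower_frame : forall f : measurableTypeR R -> R[i], L2 mu f ->
      (A%:E * (\int[mu]_x (cmod (f x) ^+ 2)%:E) <=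
       \esum_(l in range lam)
         (cmod (integralC mu
            (fun x => (f x * expi (- (2 * pi * l * x)))%R)) ^+ 2)%:E)%E) :
  (gmin lam * gmax lam <= (C ^+ 2 * pi ^+ 2 / A)%:E)%E.
Proof.
set B := C ^+ 2 * pi ^+ 2 / A.
have B0 : 0 <= B by rewrite /B -exprMn divr_ge0 ?sqr_ge0 ?ltW.
have frame := frame_translate _ _ _ _ lower_frame.
have gmin0 : (0 <= gmin lam)%E.
  by apply: le_ereal_inf_tmp => _ [c [c0 _] <-]; rewrite lee_fin.
have mulB (m c : R) : (0 < m) -> (m%:E < gmin lam)%E ->
    0 < c -> infinite_set [set k | c < gap lam k] -> m * c <= B.
  move=> m0 m_lt.
  apply: (gap_mul_le _ mu _ _ lam _ _ mu_decay lam_incr A_gt0 frame m0).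
  (* If infinitely many gaps were below [m], then [m] would belong to the set whose infimum is
     [gmin lam]. *)
  apply: contrapT => m_inf; move: m_lt; apply/negP; rewrite -leNgt.
  by apply: ereal_inf_lbound; exists m => //; split => //; exact: ltW.
have gmax0 : (0 <= gmax lam)%E.
  (* All gaps are positive, so [c = 0] is admissible and the supremum is not the value [-oo] of an
     empty set. *)
  apply: ereal_sup_ubound; exists 0 => //; split => // fin.
  have [K Kbd] := finite_set_int_bounded _ fin.
  have /Kbd : 0 < gap lam K.+1%:Z by rewrite subr_gt0; apply: lam_incr; lia.
  by lia.
have gmax_le (m : R) : 0 < m -> (m%:E < gmin lam)%E ->
    (gmax lam <= (B / m)%:E)%E.
  move=> m0 m_lt; apply: ge_ereal_sup => _ [c [c0 c_inf] <-].
  rewrite lee_fin ler_pdivlMr// mulrC.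
  move: c0; rewrite le_eqVlt => /predU1P[<-|c0]; first by rewrite mulr0.
  exact: mulB.
have gmax_fin (m : R) : 0 < m -> (m%:E < gmin lam)%E ->
    exists2 g, 0 <= g & gmax lam = g%:E.
  move=> m0 /(gmax_le _ m0); case: (gmax lam) gmax0 => [g|//|//].
  by rewrite lee_fin => g0 _; exists g.
case: (gmin lam) gmin0 gmax_le gmax_fin => [r|_ gmax_le gmax_fin|//].
  rewrite lee_fin le_eqVlt => /predU1P[<- _ _|r0 gmax_le gmax_fin].
    (* [gmax lam] may be infinite here; the convention that 0 times infinity is 0 applies. *)
    by rewrite mul0e lee_fin.
  have [|g g0 gE] := gmax_fin (r / 2) (divr_gt0 r0 (ltr0Sn _ 1)).
    by rewrite lte_fin; lra.
  rewrite gE -EFinM lee_fin leNgt; apply/negP => Bg.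
  have {}g0 : 0 < g by rewrite lt_neqAle g0 andbT; apply/eqP => g0'; nra.
  have Bgr : B / g < r by rewrite ltr_pdivrMr.
  have Bg0 : 0 <= B / g by rewrite divr_ge0// ltW.
  (* If [B < r * g], the midpoint [m] of [B / g] and [r] is below [gmin lam] but has [g * m > B],
     against [gmax_le]. *)
  have m0 : 0 < (B / g + r) / 2 by lra.
  have := gmax_le _ m0; rewrite gE lte_fin lee_fin ler_pdivlMr//.
  have -> : g * ((B / g + r) / 2) = (B + r * g) / 2 by field; rewrite gt_eqF.
  by move=> /(_ ltac:(lra)); lra.
(* With [gmin lam] infinite every [m > 0] is allowed; [m = (B + 1) / g] would give [B + 1 <= B], so
   [gmax lam] is 0. *)
have [g g0 gE] := gmax_fin 1 ltr01 (ltry _).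
suff -> : gmax lam = 0%E by rewrite mule0 lee_fin.
rewrite gE; congr (_%:E); apply/eqP; rewrite eq_le g0 andbT leNgt.
apply/negP => {}g0; have m0 : 0 < (B + 1) / g by rewrite divr_gt0// ltr_wpDl.
have := gmax_le _ m0 (ltry _); rewrite gE lee_fin ler_pdivlMr//.
by rewrite mulrC divfK ?gt_eqF//; lra.
Qed.
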